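(* Let $p\in(\tfrac14,\tfrac13]$ and let $\mathbf s\in\mathbb S=\prod_{k=0}^\infty\{0,1\}^{4^k}$. Then the generalised $p$-Koch curve $\mathcal C(\mathbf s)$ is a continuous curve of infinite length with endpoints $P_-=(-\tfrac12,0)$ and $P_+=(\tfrac12,0)$.
   Context: Notation: $\mathbb N=\{1,2,\dots\}$, $\mathbb N_0=\mathbb N\cup\{0\}$, $p\in(\tfrac14,\tfrac13]$, $q=\sqrt{4p-1}$. $V\subset\mathbb R^2$ is the closed filled-in rhombus (closed convex hull) with vertices $P_\pm=(\pm\tfrac12,0)$ and $Q_\pm=(0,\pm\tfrac12 q)$. Maps: for $(a,b)\in A=\{0,1,2,3\}\times\{0,1\}$ the affine maps $\phi_{(a,b)}$ (which map $V$ into $V$) are $\phi_{(0,0)}(x,y)=\phi_{(0,1)}(x,y)=(px-\tfrac{1-p}{2},\,py)$; $\phi_{(3,0)}(x,y)=\phi_{(3,1)}(x,y)=(px+\tfrac{1-p}{2},\,py)$; $\phi_{(1,0)}(x,y)=\big(\tfrac12((1-2p)x-qy)+\tfrac{2p-1}{4},\ \tfrac12(qx+(1-2p)y)+\tfrac q4\big)$; $\phi_{(2,0)}(x,y)=\big(\tfrac12((1-2p)x+qy)+\tfrac{1-2p}{4},\ \tfrac12(-qx+(1-2p)y)+\tfrac q4\big)$; $\phi_{(1,1)}(x,y)=\big(\tfrac12((1-2p)x+qy)+\tfrac{2p-1}{4},\ \tfrac12(-qx+(1-2p)y)-\tfrac q4\big)$; $\phi_{(2,1)}(x,y)=\big(\tfrac12((1-2p)x-qy)+\tfrac{1-2p}{4},\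 \tfrac12(qx+(1-2p)y)-\tfrac q4\big)$. Generalised $p$-Koch curves: an element $\mathbf s\in\mathbb S$ is written $\mathbf s=((s_k(0),s_k(1),\dots,s_k(4^k-1)))_{k=0}^\infty$ with $s_k(i)\in\{0,1\}$. For $\mathbf u=(u_k)_{k\in\mathbb N}\in\{0,1,2,3\}^{\mathbb N}$ put $\omega_1(\mathbf u,\mathbf s)=(u_1,s_0(0))$ and, for $k\ge2$, $\omega_k(\mathbf u,\mathbf s)=\big(u_k,\,s_{k-1}(\sum_{j=1}^{k-1}u_j4^{k-1-j})\big)\in A$. Let $\Sigma(\mathbf s)=\{(\omega_k(\mathbf u,\mathbf s))_{k\in\mathbb N}:\mathbf u\in\{0,1,2,3\}^{\mathbb N}\}$. The generalised $p$-Koch curve associated with $\mathbf s$ is $$\mathcal C(\mathbf s)=\bigcup_{(\omega_k)_{k\in\mathbb N}\in\Sigma(\mathbf s)}\ \bigcap_{k\in\mathbb N}(\phi_{\omega_1}\circ\cdots\circ\phi_{\omega_k})(V).$$ *)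

(* Defs.v *)
From HB Require Import structures.
From mathcomp Require Import all_boot all_order all_algebra.
From mathcomp Require Import all_classical all_reals all_analysis.

Set Implicit Arguments.
Unset Strict Implicit.
Unset Printing Implicit Defensive.

Import Order.TTheory GRing.Theory Num.Theory.
Import numFieldNormedType.Exports.

Local Open Scope classical_set_scope.
Local Open Scope ring_scope.

(* [R^o] rather than [R], so that the plane is a module over [R].  The library
   norm on a product is the maximum norm: it gives the right topology, but the
   Euclidean distance has to be written out. *)

Definition edist (R : realType) (v w : R^o * R^o) : R :=
  Num.sqrt ((v.1 - w.1) ^+ 2 + (v.2 - w.2) ^+ 2).

Section Curves.
Context {R : realType}.
Implicit Types (g : R -> R^o * R^o) (C : set (R^o * R^o)).

Definition parametrises g C : Prop :=
  {within `[0, 1], continuous g} /\ g @` `[0, 1] = C.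

(* Total length of the polygon inscribed in [g] at the nodes [0 :: t]. *)
Definition polygon_length g (t : seq R) : R :=
  \sum_(0 <= i < size t) edist (g (nth 1 (0 :: t) i)) (g (nth 1 (0 :: t) i.+1)).

Definition path_length g : \bar R :=
  ereal_sup [set (polygon_length g t)%:E | t in itv_partition 0 1].

(* Length of a curve given as a subset of the plane.  A curve may be traversed
   back and forth, so a single parametrisation of infinite length would say
   nothing about the set; the infimum over all parametrisations does. *)
Definition curve_length C : \bar R :=
  ereal_inf [set path_length g | g in [set g | parametrises g C]].

End Curves.

Section Koch.
Context {R : realType}.
Variable p : R.

Definition q : R := Num.sqrt (4 * p - 1).

Definition Pminus : R^o * R^o := (- (1 / 2), 0).
Definition Pplus : R^o * R^o := (1 / 2, 0).
Definition Qminus : R^o * R^o := (0, - (1 / 2 * q)).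
Definition Qplus : R^o * R^o := (0, 1 / 2 * q).

Definition V : set (R^o * R^o) :=
  smallest [set A : set (R^o * R^o) | closed A /\ convex_set A]
    [set v | [\/ v = Pminus, v = Pplus, v = Qminus | v = Qplus]].

(* The second component of a label is a bit, [false] for 0 and [true] for 1. *)
Definition phi (a : 'I_4 * bool) (v : R^o * R^o) : R^o * R^o :=
  let: (x, y) := v in
  match nat_of_ord a.1, a.2 with
  | 0%N, _ => (p * x - (1 - p) / 2, p * y)
  | 1%N, false => (1 / 2 * ((1 - 2 * p) * x - q * y) + (2 * p - 1) / 4,
                   1 / 2 * (q * x + (1 - 2 * p) * y) + q / 4)
  | 2%N, false => (1 / 2 * ((1 - 2 * p) * x + q * y) + (1 - 2 * p) / 4,
                   1 / 2 * (- q * x + (1 - 2 * p) * y) + q / 4)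
  | 1%N, true => (1 / 2 * ((1 - 2 * p) * x + q * y) + (2 * p - 1) / 4,
                  1 / 2 * (- q * x + (1 - 2 * p) * y) - q / 4)
  | 2%N, true => (1 / 2 * ((1 - 2 * p) * x - q * y) + (1 - 2 * p) / 4,
                  1 / 2 * (q * x + (1 - 2 * p) * y) - q / 4)
  | _, _ => (p * x + (1 - p) / 2, p * y)
  end.

End Koch.

Definition koch_index : Type := forall k : nat, 'I_(4 ^ k) -> bool.

(* Sequences indexed by {1, 2, ...} in the mathematics are indexed from 0 here:
   [u k] stands for u_{k+1}, and [omega s u k] for omega_{k+1}(u, s). *)
Definition address (u : nat -> 'I_4) (k : nat) : nat :=
  (\sum_(j < k) u j * 4 ^ (k - j.+1))%N.

Lemma address_lt (u : nat -> 'I_4) (k : nat) : (address u k < 4 ^ k)%N.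
Proof.
elim: k => [|k IHk]; first by rewrite /address big_ord0.
have -> : address u k.+1 = (address u k * 4 + u k)%N.
  rewrite /address big_ord_recr /= subnn muln1; congr addn.
  rewrite big_distrl /=; apply: eq_bigr => j _.
  by rewrite subSn // expnSr mulnA.
rewrite expnSr.
apply: (@leq_trans ((address u k).+1 * 4)%N); last by rewrite leq_mul2r IHk.
by rewrite mulSn [(4 + _)%N]addnC ltn_add2l ltn_ord.
Qed.

Definition omega (s : koch_index) (u : nat -> 'I_4) (k : nat) : 'I_4 * bool :=
  (u k, s k (Ordinal (address_lt u k))).

Definition Sigma (s : koch_index) : set (nat -> 'I_4 * bool) :=
  range (omega s).

(* phi_{w 0} \o ... \o phi_{w (n-1)} *)
Definition phi_word (R : realType) (p : R) (w : nat -> 'I_4 * bool) (n : nat) :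
    R^o * R^o -> R^o * R^o :=
  \big[comp/idfun]_(i < n) phi p (w i).

Definition koch_curve (R : realType) (p : R) (s : koch_index) :
    set (R^o * R^o) :=
  \bigcup_(w in Sigma s) \bigcap_(k : nat) phi_word p w k.+1 @` V p.

(* Main.v *)
Require Import Defs.
From mathcomp Require Import all_boot all_order all_algebra.
From mathcomp Require Import all_classical all_reals all_analysis.
From mathcomp Require Import ring lra zify.
Import Order.TTheory GRing.Theory Num.Theory.
Import numFieldNormedType.Exports.
Local Open Scope classical_set_scope.
Local Open Scope ring_scope.

(** The maps are similarities of ratio [p < 1] that send the rhombus into
    itself, so the cells [phi_word p w n @` V p] along a word of labels shrink
    to one point, [cell_limit w], and the curve is the set of these points
    over the words that [s] admits ([koch_curveE]).

    Parametrisation. Read the digits of a word as a base 4 expansion of a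
    number [t] of the interval [0, 1]. The cells of rank [k] form a chain,
    each sharing an endpoint with the next ([cells_joint]), so two parameters
    closer than [4 ^ - k] have points at distance at most [4 p ^ k]
    ([codes_near]). Hence the point depends on [t] only and depends on it
    continuously; the expansions of 0 and 1 give the endpoints [Pminus] and
    [Pplus].

    Length. A bound must hold for every parametrisation, so it has to come
    from the set: if a set contains [M] points pairwise [e] apart, then any
    path through it has an inscribed polygon of length at least [(M - 3) e]
    ([polygon_length_separated]). Such points exist by the open set condition:
    the children of a cell are separated by lines ([children_separated]), and
    the joint of the first two children lies on the curve and well inside the
    rhombus ([joint_deep]). Its images in the [4 ^ k] cells of rank [k] are
    therefore at distance at least [p q p ^ k] from each other
    ([joint_points_separated]). As [4 p > 1], the product of the number of
    points and their distance is unbounded. *)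

Set Implicit Arguments.
Unset Strict Implicit.
Unset Printing Implicit Defensive.

(* Not the extended distance of the library, which has the same short name. *)
Local Notation edist := Defs.edist.

(** * The rhombus *)

Section Rhombus.
Context {R : realType}.
Implicit Types (v w : R^o * R^o).

Definition mix (t : R) v w : R^o * R^o :=
  (t * v.1 + (1 - t) * w.1, t * v.2 + (1 - t) * w.2).

(** The library states convexity through its own interval and convex-space
    structures; the form with real weights is the one that computes. *)
Lemma convex_setP (A : set (R^o * R^o)) :
  convex_set A <->
  (forall t v w, 0 <= t <= 1 -> A v -> A w -> A (mix t v w)).
Proof.
split=> [cA t v w /andP[t0 t1] Av Aw | cA v w t Av Aw].
  have := cA v w (Itv01 t0 t1); rewrite !inE => /(_ Av Aw).
  by [].
have t01 : 0 <= t%:num <= 1 by rewrite ge0 le1.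
exact: (mem_set (cA _ _ _ t01 (set_mem Av) (set_mem Aw))).
Qed.

Lemma edist_sq v w : (edist v w) ^+ 2 = (v.1 - w.1) ^+ 2 + (v.2 - w.2) ^+ 2.
Proof. by rewrite sqr_sqrtr // addr_ge0 // sqr_ge0. Qed.

Lemma edist_nneg v w : 0 <= edist v w.
Proof. exact: sqrtr_ge0. Qed.

(** The maximum norm carries the topology and the triangle inequality, the
    Euclidean distance is the one that similarities scale; one inequality
    between them is enough to pass from the second to the first. *)
Lemma norm_le_edist v w : `|v - w| <= edist v w.
Proof.
rewrite prod_normE /= ge_max; apply/andP; split.
  by rewrite -sqrtr_sqr ler_wsqrtr // lerDl sqr_ge0.
by rewrite -sqrtr_sqr ler_wsqrtr // lerDr sqr_ge0.
Qed.

(** The Cauchy-Schwarz inequality in the plane. *)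
Lemma edist_functional (a b n : R) v w : 0 <= n -> n ^+ 2 = a ^+ 2 + b ^+ 2 ->
  a * (v.1 - w.1) + b * (v.2 - w.2) <= n * edist v w.
Proof.
move=> n0 nE; set D := edist v w.
have nD : 0 <= n * D by rewrite mulr_ge0 // edist_nneg.
rewrite (le_trans (ler_norm _)) // -(@ler_pXn2r _ 2) ?nnegrE //.
rewrite real_normK ?num_real // exprMn nE edist_sq -subr_ge0.
set x := v.1 - w.1; set y := v.2 - w.2.
have -> : (a ^+ 2 + b ^+ 2) * (x ^+ 2 + y ^+ 2) - (a * x + b * y) ^+ 2
          = (a * y - b * x) ^+ 2 by ring.
exact: sqr_ge0.
Qed.

Variable p : R.
Hypothesis hp : 1 / 4 < p <= 1 / 3.
Local Notation qp := (q p).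

Lemma ratio_gt0 : 0 < p.
Proof. by case/andP: hp => h1 _; lra. Qed.

Lemma ratio_range : 0 <= p < 1.
Proof. by case/andP: hp => h1 h2; apply/andP; split; lra. Qed.

Lemma q_sqr : qp ^+ 2 = 4 * p - 1.
Proof. by rewrite sqr_sqrtr //; case/andP: hp => h1 _; lra. Qed.

Lemma q_gt0 : 0 < qp.
Proof. by rewrite sqrtr_gt0; case/andP: hp => h1 _; lra. Qed.

Lemma q_le1 : qp <= 1.
Proof.
rewrite -(@ler_pXn2r _ 2) ?nnegrE // ?(ltW q_gt0) // q_sqr expr1n.
by case/andP: hp => _ h2; lra.
Qed.

Lemma closed_V : closed (V p).
Proof. by apply: closed_bigI => A [[]]. Qed.

Lemma convex_V : convex_set (V p).
Proof.
apply/convex_setP => t v w t01 Vv Vw A hA.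
by apply: ((convex_setP A).1 hA.1.2 t v w t01); [exact: Vv | exact: Vw].
Qed.

Lemma V_vertices : [/\ V p Pminus, V p Pplus, V p (Qminus p) & V p (Qplus p)].
Proof.
split=> A [_]; apply.
- exact: (Or41 _ _ _ erefl).
- exact: (Or42 _ _ _ erefl).
- exact: (Or43 _ _ _ erefl).
- exact: (Or44 _ _ _ erefl).
Qed.

Lemma functional_continuous (a b : R) :
  continuous (fun v : R^o * R^o => a * v.1 + b * v.2 : R^o).
Proof.
by move=> v; apply: cvgD; apply: cvgM; (try exact: cvg_cst);
  [exact: cvg_fst | exact: cvg_snd].
Qed.

(** A half-plane is closed and convex, so it contains the hull as soon as it
    contains the four vertices; the hypotheses are the bound at each vertex. *)
Lemma V_functional_le (a b c : R) :
  a <= 2 * c -> - a <= 2 * c -> b * qp <= 2 * c -> - (b * qp) <= 2 * c ->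
  forall v, V p v -> a * v.1 + b * v.2 <= c.
Proof.
move=> h1 h2 h3 h4.
suff: V p `<=` [set v | a * v.1 + b * v.2 <= c] by [].
apply: smallest_sub => [|v /=].
  split.
    exact: (closed_comp (fun v _ => @functional_continuous a b v)
                        (@closed_le R c)).
  apply/convex_setP => t v w /andP[t0 t1] /= hv hw.
  have : t * (a * v.1 + b * v.2) + (1 - t) * (a * w.1 + b * w.2)
         <= t * c + (1 - t) * c.
    by rewrite lerD // ler_wpM2l // subr_ge0.
  lra.
by case=> -> /=; rewrite -/qp; lra.
Qed.

Lemma V_coord v : V p v ->
  [/\ - (1/2) <= v.1, v.1 <= 1/2, - (1/2) <= v.2 & v.2 <= 1/2].
Proof.
move=> Vv; have q1 := q_le1; have q0 := q_gt0.
have H1 : 1 * v.1 + 0 * v.2 <= 1/2 by apply: V_functional_le Vv; lra.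
have H2 : (-1) * v.1 + 0 * v.2 <= 1/2 by apply: V_functional_le Vv; lra.
have H3 : 0 * v.1 + 1 * v.2 <= 1/2 by apply: V_functional_le Vv; lra.
have H4 : 0 * v.1 + (-1) * v.2 <= 1/2 by apply: V_functional_le Vv; lra.
by split; lra.
Qed.

Lemma V_diam v w : V p v -> V p w -> edist v w <= 2.
Proof.
move=> /V_coord[a1 a2 a3 a4] /V_coord[b1 b2 b3 b4].
rewrite -(@ler_pXn2r _ 2) ?nnegrE ?edist_nneg // edist_sq.
have : (v.1 - w.1) ^+ 2 <= 1 by nra.
have : (v.2 - w.2) ^+ 2 <= 1 by nra.
lra.
Qed.

Lemma compact_V : compact (V p).
Proof.
pose I : set R^o := `[- (1/2), 1/2]%classic.
have cK : compact (I `*` I).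
  by apply: compact_setX; exact: segment_compact.
apply: (subclosed_compact closed_V cK) => v /V_coord[h1 h2 h3 h4].
by split; rewrite /I /= in_itv /= ?h1 ?h2 ?h3 ?h4.
Qed.

End Rhombus.

(** * The similarities *)

Section Maps.
Context {R : realType}.
Implicit Types (v w : R^o * R^o).
Variable p : R.
Hypothesis hp : 1 / 4 < p <= 1 / 3.
Local Notation qp := (q p).

Lemma V_mix3 (a b c : R) u v w : 0 <= a -> 0 <= b -> 0 <= c -> a + b + c = 1 ->
  V p u -> V p v -> V p w ->
  V p (a * u.1 + b * v.1 + c * w.1, a * u.2 + b * v.2 + c * w.2).
Proof.
move=> a0 b0 c0 abc Vu Vv Vw.
have mixV := (convex_setP (V p)).1 (@convex_V R p).
have [ab0|ab0] := eqVneq (a + b) 0.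
  have [-> [-> ->]] : a = 0 /\ b = 0 /\ c = 1 by split; [|split]; lra.
  by rewrite !mul0r !mul1r !add0r -surjective_pairing.
have ab : 0 < a + b by rewrite lt_neqAle eq_sym ab0 addr_ge0.
have t01 : 0 <= a / (a + b) <= 1.
  by rewrite divr_ge0 ?(ltW ab) //= ler_pdivrMr // mul1r lerDl.
have c01 : 0 <= c <= 1 by rewrite c0 /=; lra.
have := mixV _ _ _ c01 Vw (mixV _ _ _ t01 Vu Vv).
have -> : c = 1 - (a + b) by lra.
by congr (V p _); rewrite /mix /=; congr pair; field.
Qed.

(** The four inequalities say that the coordinates [x] and [t = y / q] satisfy
    [|x| + |t| <= 1/2]; then [v] is a mixture of [Pminus], [Pplus] and the one
    of [Qminus], [Qplus] on its side of the horizontal axis. *)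
Lemma rhombus_sub_V v :
  qp * v.1 + v.2 <= qp / 2 -> qp * v.1 - v.2 <= qp / 2 ->
  - (qp * v.1) + v.2 <= qp / 2 -> - (qp * v.1) - v.2 <= qp / 2 -> V p v.
Proof.
have [VP VP' VQ VQ'] := V_vertices p.
have q0 : 0 < qp := q_gt0 hp.
case: v => x y /=; set t := y / qp.
have -> : y = t * qp by rewrite /t divfK // gt_eqF.
move=> h1 h2 h3 h4.
have {}h1 : x + t <= 1/2 by nra.
have {}h2 : x - t <= 1/2 by nra.
have {}h3 : - x + t <= 1/2 by nra.
have {}h4 : - x - t <= 1/2 by nra.
have [t0|t0] := leP 0 t.
  have : 0 <= (1 - 2 * t - 2 * x) / 2 by lra.
  have : 0 <= (1 - 2 * t + 2 * x) / 2 by lra.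
  have : 0 <= 2 * t by lra.
  move=> k1 k2 k3; have := V_mix3 k3 k2 k1 _ VP VP' VQ'.
  have -> : (1 - 2 * t - 2 * x) / 2 + (1 - 2 * t + 2 * x) / 2 + 2 * t = 1.
    by field.
  by move=> /(_ erefl) /=; congr (V p _); congr pair; rewrite -/qp; field.
have : 0 <= (1 + 2 * t - 2 * x) / 2 by lra.
have : 0 <= (1 + 2 * t + 2 * x) / 2 by lra.
have : 0 <= - (2 * t) by lra.
move=> k1 k2 k3; have := V_mix3 k3 k2 k1 _ VP VP' VQ.
have -> : (1 + 2 * t - 2 * x) / 2 + (1 + 2 * t + 2 * x) / 2 + - (2 * t) = 1.
  by field.
by move=> /(_ erefl) /=; congr (V p _); congr pair; rewrite -/qp; field.
Qed.

(** All the eight maps preserve orientation: the linear part is multiplication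
    by the complex number [c + i d], of modulus [p] because [q ^ 2 = 4 p - 1]. *)
Lemma phi_similarity a : exists c d e f : R, c ^+ 2 + d ^+ 2 = p ^+ 2 /\
  forall v, phi p a v = (c * v.1 - d * v.2 + e, d * v.1 + c * v.2 + f).
Proof.
have q2 : qp ^+ 2 = 4 * p - 1 := q_sqr hp.
case: a => -[[|[|[|[|//]]]] hi] [].
- exists p, 0, (- ((1 - p) / 2)), 0; split=> [|[x y]]; first by ring.
  by rewrite /phi /=; congr pair; ring.
- exists p, 0, (- ((1 - p) / 2)), 0; split=> [|[x y]]; first by ring.
  by rewrite /phi /=; congr pair; ring.
- exists ((1 - 2 * p) / 2), (- qp / 2), ((2 * p - 1) / 4), (- qp / 4).
  split=> [|[x y]]; first by lra.
  by rewrite /phi /=; congr pair; rewrite -/qp; field.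
- exists ((1 - 2 * p) / 2), (qp / 2), ((2 * p - 1) / 4), (qp / 4).
  split=> [|[x y]]; first by lra.
  by rewrite /phi /=; congr pair; rewrite -/qp; field.
- exists ((1 - 2 * p) / 2), (qp / 2), ((1 - 2 * p) / 4), (- qp / 4).
  split=> [|[x y]]; first by lra.
  by rewrite /phi /=; congr pair; rewrite -/qp; field.
- exists ((1 - 2 * p) / 2), (- qp / 2), ((1 - 2 * p) / 4), (qp / 4).
  split=> [|[x y]]; first by lra.
  by rewrite /phi /=; congr pair; rewrite -/qp; field.
- exists p, 0, ((1 - p) / 2), 0; split=> [|[x y]]; first by ring.
  by rewrite /phi /=; congr pair; ring.
- exists p, 0, ((1 - p) / 2), 0; split=> [|[x y]]; first by ring.
  by rewrite /phi /=; congr pair; ring.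
Qed.

Lemma edist_phi a v w : edist (phi p a v) (phi p a w) = p * edist v w.
Proof.
have p0 : 0 <= p by case/andP: hp => h1 _; lra.
have [c [d [e [f [cd E]]]]] := phi_similarity a.
have : edist (phi p a v) (phi p a w) ^+ 2 = (p * edist v w) ^+ 2.
  by rewrite exprMn !edist_sq !E /= -cd; ring.
move/(pexpIrn (ltn0Sn 1)); apply; rewrite nnegrE; first exact: edist_nneg.
by apply: mulr_ge0 p0 _; exact: edist_nneg.
Qed.

Lemma phi_continuous a : continuous (phi p a).
Proof.
have [c [d [e [f [_ E]]]]] := phi_similarity a.
have -> : phi p a = fun v => ((c * v.1 + (- d) * v.2 : R^o) + e,
    (d * v.1 + c * v.2 : R^o) + f) :> R^o * R^o.
  by apply/funext => v; rewrite E mulNr.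
move=> v.
exact: (cvg_pair (cvgD (@functional_continuous R c (- d) v) (cvg_cst (e : R^o)))
                 (cvgD (@functional_continuous R d c v) (cvg_cst (f : R^o)))).
Qed.

(** The preimage of the rhombus under an affine map is closed and convex,
    hence only the images of the vertices have to be located in the rhombus. *)
Lemma phi_sub_V a v : V p v -> V p (phi p a v).
Proof.
suff: V p `<=` phi p a @^-1` V p by apply.
have q2 : qp ^+ 2 = 4 * p - 1 := q_sqr hp.
have q0 : 0 < qp := q_gt0 hp.
apply: smallest_sub => [|u].
  split.
    have /continuous_closedP := @phi_continuous a.
    by apply; exact: closed_V.
  apply/convex_setP => t u w t01 Vu Vw.
  change (V p (phi p a (mix t u w))).
  have := (convex_setP (V p)).1 (@convex_V R p) _ _ _ t01 Vu Vw.
  have [c [d [e [f [_ E]]]]] := phi_similarity a.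
  by congr (V p _); rewrite /mix !E /=; congr pair; ring.
have p1 : 0 <= qp * (1 - 3 * p) by case/andP: hp => h1 h2; nra.
have p2 : 0 <= qp * (4 * p - 1) by case/andP: hp => h1 h2; nra.
have q3 : qp ^+ 3 = 4 * p * qp - qp by rewrite exprS q2; ring.
(* The image of a vertex involves [q] up to the cube; with [q2], [q3] and the sign
   conditions [p1], [p2] the inequalities are linear in the remaining monomials. *)
move=> hu; apply: rhombus_sub_V;
case: a hu => -[[|[|[|[|//]]]] hi] [] [] -> /=; rewrite -/qp; lra.
Qed.

End Maps.

(** * Cells and their limit points *)

Section Words.
Context {R : realType}.
Variable p : R.
Hypothesis hp : 1 / 4 < p <= 1 / 3.
Implicit Types (w : nat -> 'I_4 * bool) (u v z : R^o * R^o).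

Let p_gt0 : 0 < p := ratio_gt0 hp.

Lemma exists_expr_lt (x e : R) : 0 <= x < 1 -> 0 < e -> exists k, x ^+ k < e.
Proof.
move=> /andP[x0 x1] e0.
have : x ^+ k @[k --> \oo] --> (0 : R) by apply: cvg_expr; rewrite ger0_norm.
by move/cvgr_lt => /(_ e e0) [k _ /(_ k (leqnn k)) /= h]; exists k.
Qed.

Let p_range : 0 <= p < 1 := ratio_range hp.

Lemma eq_phi_word w w' n : (forall i, (i < n)%N -> w i = w' i) ->
  phi_word p w n = phi_word p w' n.
Proof. by move=> h; apply: eq_bigr => i _; rewrite h. Qed.

Lemma phi_word0 w : phi_word p w 0 = idfun.
Proof. by rewrite /phi_word big_ord0. Qed.

Lemma phi_wordS w n :
  phi_word p w n.+1 = phi p (w 0%N) \o phi_word p (w \o succn) n.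
Proof. by rewrite /phi_word big_ord_recl. Qed.

Lemma phi_word_cat w m n v :
  phi_word p w (m + n) v = phi_word p w m (phi_word p (w \o addn m) n v).
Proof.
elim: m w => [|m IH] w; first by rewrite phi_word0.
by rewrite addSn !phi_wordS /comp IH.
Qed.

Lemma phi_word_recr w n v :
  phi_word p w n.+1 v = phi_word p w n (phi p (w n) v).
Proof. by rewrite -addn1 phi_word_cat phi_wordS phi_word0 /comp addn0. Qed.

Lemma edist_phi_word w n u v :
  edist (phi_word p w n u) (phi_word p w n v) = p ^+ n * edist u v.
Proof.
elim: n w => [|n IH] w; first by rewrite phi_word0 mul1r.
by rewrite phi_wordS /= edist_phi // IH mulrA exprS.
Qed.

Lemma phi_word_continuous w n : continuous (phi_word p w n).
Proof.
elim: n w => [|n IH] w; first by rewrite phi_word0; move=> x; exact: cvg_id.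
rewrite phi_wordS => x; apply: continuous_comp; first exact: IH.
exact: phi_continuous.
Qed.

Definition cell w n : set (R^o * R^o) := phi_word p w n @` V p.

Lemma phi_word_V w n v : V p v -> V p (phi_word p w n v).
Proof.
elim: n w => [|n IH] w Vv; first by rewrite phi_word0.
by rewrite phi_wordS /=; apply: phi_sub_V => //; exact: IH.
Qed.

Lemma cell_phi_word w m n v : (m <= n)%N -> V p v -> cell w m (phi_word p w n v).
Proof.
move=> mn Vv; rewrite -(subnKC mn) phi_word_cat.
by exists (phi_word p (w \o addn m) (n - m) v) => //; exact: phi_word_V.
Qed.

Lemma closed_cell w n : closed (cell w n).
Proof.
apply: compact_closed; first exact: norm_hausdorff.
apply: continuous_compact; last exact: compact_V.
by apply: continuous_subspaceT; exact: phi_word_continuous.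
Qed.

Lemma cell_dist w n u v : cell w n u -> cell w n v -> `|u - v| <= 2 * p ^+ n.
Proof.
move=> [u' Vu <-] [v' Vv <-].
rewrite (le_trans (norm_le_edist _ _)) // edist_phi_word mulrC.
by rewrite ler_wpM2r ?exprn_ge0 ?(ltW p_gt0) // (V_diam hp).
Qed.

(** The images of [Pminus] under the growing prefixes all lie in the compact
    rhombus, and from rank [n] on in the closed cell of rank [n]; a cluster
    point of this sequence therefore lies in every cell. *)
Lemma cell_limit_exists w : exists z, forall n, cell w n z.
Proof.
have [VP _ _ _] := V_vertices p.
pose x n := phi_word p w n Pminus.
have Fx n : (x @ \oo) (cell w n).
  by exists n => // m /= nm; exact: cell_phi_word.
have FV : (x @ \oo) (V p).
  by exists 0%N => // m _; exact: phi_word_V.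
have [z [_ clz]] := compact_V hp (F := x @ \oo) _ FV.
exists z => n; apply: closed_cell => B Bz.
exact: clz.
Qed.

(** Two common points are at distance at most [2 p ^ n] for all [n]. The index
    on the left starts at 1, as in the definition of the curve. *)
Lemma cell_limit_unique w u v :
  (forall n, cell w n.+1 u) -> (forall n, cell w n v) -> u = v.
Proof.
move=> hu hv; apply/eqP; rewrite -subr_eq0 -normr_eq0 eq_le normr_ge0 andbT.
rewrite leNgt; apply/negP => d0.
have [k] : exists k, p ^+ k < `|u - v| / 2.
  by apply: (exists_expr_lt p_range); rewrite divr_gt0.
rewrite ltr_pdivlMr // mulrC ltNge => /negP; apply.
apply: (le_trans (cell_dist (hu k) (hv k.+1))).
rewrite ler_wpM2l // exprS ler_piMl ?exprn_ge0 ?(ltW p_gt0) //.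
by case/andP: hp => _ h2; lra.
Qed.

Definition cell_limit w := projT1 (cid (cell_limit_exists w)).

Lemma cell_limitP w n : cell w n (cell_limit w).
Proof. exact: (projT2 (cid (cell_limit_exists w))). Qed.

Lemma cell_limit_eq w u : (forall n, cell w n.+1 u) -> cell_limit w = u.
Proof. by move=> hu; apply/esym/(cell_limit_unique hu)/cell_limitP. Qed.

(** Every intersection of cells is a single point, so the curve is the set of
    these points. *)
Lemma koch_curveE (s : koch_index) :
  koch_curve p s = range (fun d => cell_limit (omega s d)).
Proof.
apply/seteqP; split=> [z [w [d _ <-] hz]|z [d _ <-]].
  by exists d => //; apply: cell_limit_eq => n; exact: hz.
by exists (omega s d); [exists d|move=> n _; exact: cell_limitP].
Qed.

End Words.

(** * Addresses *)

Section Addresses.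
Implicit Types (d e : nat -> 'I_4).

Lemma addressS d k : address d k.+1 = (address d k * 4 + d k)%N.
Proof.
rewrite /address big_ord_recr /= subnn muln1; congr addn.
rewrite big_distrl /=; apply: eq_bigr => j _.
by rewrite subSn // expnSr mulnA.
Qed.

Lemma address0 d : address d 0 = 0%N.
Proof. by rewrite /address big_ord0. Qed.

Lemma eq_address d e k : (forall i, (i < k)%N -> d i = e i) ->
  address d k = address e k.
Proof. by move=> h; apply: eq_bigr => i _; rewrite h. Qed.

Lemma address_inj d e k : address d k = address e k ->
  forall i, (i < k)%N -> d i = e i.
Proof.
elim: k => // k IH; rewrite !addressS => h i.
have dk : d k = e k.
  apply: val_inj => /=; move/(congr1 (modn^~ 4)): h.
  by rewrite !modnMDl !modn_small.
rewrite ltnS leq_eqVlt => /predU1P[-> //|]; apply: IH.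
by move: h; rewrite dk => /addIn /eqP; rewrite eqn_mul2r => /eqP.
Qed.

Lemma omega_bit (s : koch_index) d e k : address d k = address e k ->
  (omega s d k).2 = (omega s e k).2.
Proof. by move=> h; rewrite /omega /=; congr (s k _); exact: val_inj. Qed.

(** The bits attached to a digit depend on the address of the preceding digits
    only, so an address determines a whole word of labels. *)
Lemma address_omega (s : koch_index) d e k : address d k = address e k ->
  forall i, (i < k)%N -> omega s d i = omega s e i.
Proof.
move=> h i ik; have hde := address_inj h.
have hi : address d i = address e i.
  by apply: eq_address => j ji; apply: hde; exact: ltn_trans ik.
by apply: injective_projections; [exact: hde | exact: omega_bit].
Qed.

End Addresses.

(** * The parametrisation *)

Section Param.
Context {R : realType}.
Variable p : R.
Hypothesis hp : 1 / 4 < p <= 1 / 3.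
Variable s : koch_index.
Implicit Types (d e : nat -> 'I_4) (t : R).

Let p_gt0 : 0 < p := ratio_gt0 hp.

Let p_range : 0 <= p < 1 := ratio_range hp.

Lemma phi_first_fixed (a : 'I_4 * bool) : a.1 = 0%N :> nat ->
  phi p a Pminus = Pminus.
Proof. by case: a => [[i hi] b] /= ->; rewrite /phi /=; congr pair; field. Qed.

Lemma phi_last_fixed (a : 'I_4 * bool) : a.1 = 3%N :> nat ->
  phi p a Pplus = Pplus.
Proof. by case: a => [[i hi] b] /= ->; rewrite /phi /=; congr pair; field. Qed.

(** The second and third children meet at the apex [Qplus] or [Qminus] on the
    side that the bit selects; the two outer joints lie on the horizontal
    axis. *)
Lemma phi_joint (a b : 'I_4 * bool) : a.2 = b.2 -> b.1 = a.1.+1 :> nat ->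
  phi p a Pplus = phi p b Pminus.
Proof.
have q2 : q p ^+ 2 = 4 * p - 1 := q_sqr hp.
case: a b => [[i hi] x] [[j hj] y] /= -> ji; move: hj; rewrite {j}ji => hj.
move: i hi hj => [|[|[|[|//]]]] hi hj //; rewrite /phi /=; case: y;
by congr pair; field.
Qed.

(** The cells of rank [k], listed by address, form a chain linked at
    endpoints. A carry in the address means that the last digit passes from 3
    to 0: the joint is then an endpoint of the parents, which the outer
    children keep fixed, and the induction hypothesis applies to the parents. *)
Lemma cells_joint d e k : address e k = (address d k).+1 ->
  phi_word p (omega s d) k Pplus = phi_word p (omega s e) k Pminus.
Proof.
elim: k => [|k IH]; first by rewrite !address0.
rewrite !addressS !phi_word_recr => h.
have [d3|d3] := eqVneq (d k : nat) 3%N.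
  have e0 : e k = 0%N :> nat.
    by have := ltn_ord (e k); move: h; rewrite d3; lia.
  rewrite phi_last_fixed // phi_first_fixed //; apply: IH.
  by move: h; rewrite d3 e0; lia.
have ed : e k = (d k).+1 :> nat.
  by have := ltn_ord (e k); have := ltn_ord (d k); lia.
have he : address d k = address e k by move: h; rewrite ed; lia.
rewrite (eq_phi_word p (address_omega s he)); congr (phi_word _ _ _ _).
by apply: phi_joint => //; exact: omega_bit.
Qed.

Lemma phi_word_fixed w n v : (forall i, phi p (w i) v = v) ->
  phi_word p w n v = v.
Proof.
move=> h; elim: n => [|n IH]; first by rewrite phi_word0.
by rewrite phi_word_recr h.
Qed.

Lemma cell_limit_fixed w k v : V p v ->
  (forall i, phi p (w (k + i)%N) v = v) -> cell_limit hp w = phi_word p w k v.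
Proof.
move=> Vv h; apply: cell_limit_eq => n.
have [nk|kn] := leqP n.+1 k; first exact: cell_phi_word.
exists v => //; rewrite -(subnKC (ltnW kn)) phi_word_cat.
by rewrite (phi_word_fixed (w := w \o addn k)).
Qed.

(** Both ends of the interval are included, so a quaternary fraction is coded
    by both of its expansions, and 1 by the digits 3. *)
Definition codes d t := forall k,
  (address d k)%:R <= 4 ^+ k * t <= (address d k)%:R + 1.

(** Parameters closer than [4 ^ - k] have addresses of rank [k] that differ by
    at most 1, hence lie in one cell or in two cells with a common point. This
    single estimate makes the point independent of the expansion and
    continuous in the parameter. *)
Lemma codes_near d e t t' k : codes d t -> codes e t' ->
  4 ^+ k * `|t - t'| < 1 ->
  `|cell_limit hp (omega s d) - cell_limit hp (omega s e)| <= 4 * p ^+ k.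
Proof.
have p0 : 0 <= p ^+ k by rewrite exprn_ge0 // ltW.
wlog le_de : d e t t' / (address d k <= address e k)%N.
  move=> H cd ce ht; have [h|h] := leqP (address d k) (address e k).
    exact: (H d e t t').
  by rewrite distrC; apply: (H e d t' t) => //; rewrite ?(ltnW h) // distrC.
move=> /(_ k)/andP[a1 a2] /(_ k)/andP[b1 b2] ht.
have cd := cell_limitP hp (omega s d) k.
have ce := cell_limitP hp (omega s e) k.
have [VP VP' _ _] := V_vertices p.
move: le_de; rewrite leq_eqVlt => /predU1P[eq_de|lt_de].
  have cde : cell p (omega s e) k = cell p (omega s d) k.
    by rewrite /cell (eq_phi_word p (address_omega s eq_de)).
  rewrite cde in ce.
  by apply: (le_trans (cell_dist hp cd ce)); lra.
have succ_de : address e k = (address d k).+1.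
  apply/eqP; rewrite eqn_leq lt_de andbT -ltnS.
  rewrite -(@ltr_nat R) -2!natr1.
  have : 4 ^+ k * t' - 4 ^+ k * t < 1.
    rewrite -mulrBr; apply: le_lt_trans ht.
    by rewrite ler_wpM2l ?exprn_ge0 // -normrN opprB ler_norm.
  lra.
have j := cells_joint succ_de.
have jd : cell p (omega s d) k (phi_word p (omega s d) k Pplus) by exists Pplus.
have je : cell p (omega s e) k (phi_word p (omega s d) k Pplus).
  by rewrite j; exists Pminus.
rewrite (le_trans (ler_distD (phi_word p (omega s d) k Pplus) _ _)) //.
have := cell_dist hp cd jd; have := cell_dist hp je ce; lra.
Qed.

Lemma codes_eq d e t : codes d t -> codes e t ->
  cell_limit hp (omega s d) = cell_limit hp (omega s e).
Proof.
move=> cd ce; apply/eqP; rewrite -subr_eq0 -normr_eq0 eq_le normr_ge0 andbT.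
rewrite leNgt; apply/negP => d0.
set u := cell_limit _ _ in d0 *; set v := cell_limit _ _ in d0 *.
have [k] : exists k, p ^+ k < `|u - v| / 4.
  by apply: (exists_expr_lt p_range); rewrite divr_gt0.
rewrite ltr_pdivlMr // mulrC ltNge => /negP; apply.
by apply: (codes_near cd ce); rewrite subrr normr0 mulr0.
Qed.

Definition digit (r : R) : 'I_4 :=
  if 4 * r <= 1 then @Ordinal 4 0 isT else
  if 4 * r <= 2 then @Ordinal 4 1 isT else
  if 4 * r <= 3 then @Ordinal 4 2 isT else @Ordinal 4 3 isT.

(** After [k] digits, [remainder t k = 4 ^ k t - address (code t) k]; keeping
    it in the closed interval [0, 1] treats [t = 1] like the other parameters. *)
Definition remainder t k := iter k (fun r => 4 * r - (digit r)%:R) t.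

Definition code t : nat -> 'I_4 := fun k => digit (remainder t k).

Lemma digit_bounds r : 0 <= r <= 1 -> 0 <= 4 * r - (digit r)%:R <= 1.
Proof.
move=> /andP[r0 r1]; rewrite /digit.
case: (leP (4 * r) 1) => h1 /=; first by apply/andP; split; lra.
case: (leP (4 * r) 2) => h2 /=; first by apply/andP; split; lra.
by case: (leP (4 * r) 3) => h3 /=; apply/andP; split; lra.
Qed.

Lemma code_codes t : 0 <= t <= 1 -> codes (code t) t.
Proof.
move=> t01 k.
have r01 : 0 <= remainder t k <= 1.
  by elim: k => // k IH; exact: digit_bounds.
suff -> : 4 ^+ k * t = (address (code t) k)%:R + remainder t k.
  by case/andP: r01 => r0 r1; apply/andP; split; lra.
elim: {r01} k => [|k IH]; first by rewrite address0 mul1r add0r.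
rewrite addressS natrD natrM exprS -mulrA IH /= /code; ring.
Qed.

(** The intervals coded by the prefixes of [d] are nested. *)
Lemma codes_exists d : exists2 t, 0 <= t <= 1 & codes d t.
Proof.
pose a k : R := (address d k)%:R / 4 ^+ k.
pose b k : R := ((address d k)%:R + 1) / 4 ^+ k.
have p4 k : 0 < 4 ^+ k :> R by rewrite exprn_gt0.
have dk k : (0 : R) <= (d k)%:R <= (3 : R).
  by rewrite ler0n /= (ler_nat R _ 3) -ltnS ltn_ord.
have E (x : R) k : x / 4 ^+ k.+1 * 4 ^+ k = x / 4.
  by rewrite exprS; field; rewrite gt_eqF.
have a_mono : {homo a : m n / (m <= n)%N >-> m <= n}.
  apply/nondecreasing_seqP => k; rewrite /a addressS ler_pdivrMr // E.
  rewrite natrD natrM; case/andP: (dk k) => h _; lra.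
have b_mono : {homo b : m n / (m <= n)%N >-> n <= m}.
  apply/nonincreasing_seqP => k; rewrite /b addressS ler_pdivlMr // E.
  rewrite natrD natrM; case/andP: (dk k) => _ h; lra.
have ab m n : a m <= b n.
  apply: (le_trans (a_mono _ _ (leq_maxl m n))).
  apply: le_trans (b_mono _ _ (leq_maxr m n)).
  by rewrite ler_pM2r ?invr_gt0 // lerDl.
have ub_b n : ubound (range a) (b n) by move=> _ [m _ <-].
have ne : range a !=set0 by exists (a 0%N), 0%N.
have bt k : a k <= sup (range a) <= b k.
  apply/andP; split; last exact: ge_sup.
  by apply: ub_le_sup; [exists (b 0%N) | exists k].
exists (sup (range a)) => [|k].
  by have := bt 0%N; rewrite /a /b address0 expr0 !divr1 add0r.
by have := bt k; rewrite ler_pdivrMr // ler_pdivlMr // mulrC.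
Qed.

Definition koch_param t := cell_limit hp (omega s (code t)).

Lemma koch_paramE d t : 0 <= t <= 1 -> codes d t ->
  koch_param t = cell_limit hp (omega s d).
Proof. by move=> t01 cd; exact: (codes_eq (code_codes t01)). Qed.

Lemma koch_param0 : koch_param 0 = Pminus.
Proof.
have [VP VP' _ _] := V_vertices p.
rewrite (@koch_paramE (fun=> ord0)) ?lexx ?ler01 //.
  rewrite (@cell_limit_fixed _ 0 Pminus) ?phi_word0 // => i.
  exact: phi_first_fixed.
have a0 k : address (fun=> ord0) k = 0%N.
  by elim: k => [|k IH]; rewrite ?address0 // addressS IH.
by move=> k; rewrite a0 mulr0 add0r lexx ler01.
Qed.

Lemma koch_param1 : koch_param 1 = Pplus.
Proof.
have [VP VP' _ _] := V_vertices p.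
rewrite (@koch_paramE (fun=> ord_max)) ?lexx ?ler01 //.
  rewrite (@cell_limit_fixed _ 0 Pplus) ?phi_word0 // => i.
  exact: phi_last_fixed.
have a1 k : (address (fun=> ord_max) k)%:R + 1 = 4 ^+ k :> R.
  elim: k => [|k IH]; first by rewrite address0 add0r.
  by rewrite addressS natrD natrM exprS -IH /=; ring.
by move=> k; rewrite mulr1 -a1 lexx lerDl ler01.
Qed.

Lemma koch_param_continuous : {within `[0, 1], continuous koch_param}.
Proof.
apply/subspace_continuousP => t /=; rewrite in_itv /= => t01.
apply/cvgrPdist_lt => e e0.
have [k hk] : exists k, p ^+ k < e / 4.
  by apply: (exists_expr_lt p_range); rewrite divr_gt0.
have d0 : 0 < (4 ^+ k)^-1 :> R by rewrite invr_gt0 exprn_gt0.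
rewrite near_withinE; apply: filterS (nbhsx_ballx t _ d0) => t'.
rewrite /ball /= in_itv /= => tt' t01'.
have {}tt' : 4 ^+ k * `|t - t'| < 1.
  by rewrite mulrC -ltr_pdivlMr ?exprn_gt0 // div1r.
apply: (le_lt_trans (codes_near (code_codes t01) (code_codes t01') tt')).
by rewrite mulrC -ltr_pdivlMr.
Qed.

Lemma koch_param_parametrises : parametrises koch_param (koch_curve p s).
Proof.
split; first exact: koch_param_continuous.
rewrite (koch_curveE hp); apply/seteqP; split=> [z [t _ <-]|z [d _ <-]].
  by exists (code t).
have [t t01 cd] := codes_exists d.
by exists t; [rewrite /= in_itv | exact: koch_paramE].
Qed.

End Param.

(** * Depth and separation of the children *)

Section Depth.
Context {R : realType}.
Implicit Types (u v w : R^o * R^o) (K L : set (R^o * R^o)).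

(** A dual form of the distance to the complement: every half-plane that
    contains [K] still contains [v] after it is moved inward by [r]. For
    closed convex [K] and [0 <= r] this says that the Euclidean disc of radius
    [r] about [v] lies in [K]. The dual form pulls back along similarities
    without inverting them. *)
Definition deep K r v := forall a b n c : R,
  0 <= n -> n ^+ 2 = a ^+ 2 + b ^+ 2 ->
  (forall w, K w -> a * w.1 + b * w.2 <= c) -> a * v.1 + b * v.2 + r * n <= c.

Lemma deep_subset K L r v : K `<=` L -> deep K r v -> deep L r v.
Proof. by move=> KL h a b n c n0 nE Lc; apply: h => // w /KL; exact: Lc. Qed.

(** When a line separates two sets, a point of depth [r] in either stays at
    distance [r] from the line. *)
Lemma deep_separated K L r u v (a b c : R) : 0 < a ^+ 2 + b ^+ 2 ->
  (forall w, K w -> a * w.1 + b * w.2 <= c) ->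
  (forall w, L w -> c <= a * w.1 + b * w.2) ->
  deep K r u -> deep L r v -> 2 * r <= edist u v.
Proof.
move=> ab Kc Lc hu hv; pose n := Num.sqrt (a ^+ 2 + b ^+ 2).
have n0 : 0 < n by rewrite sqrtr_gt0.
have nE : n ^+ 2 = a ^+ 2 + b ^+ 2 by rewrite sqr_sqrtr // ltW.
have h1 := hu _ _ _ _ (ltW n0) nE Kc.
have nE' : n ^+ 2 = (- a) ^+ 2 + (- b) ^+ 2 by rewrite !sqrrN.
have h2 : - a * v.1 + - b * v.2 + r * n <= - c.
  by apply: (hv _ _ _ _ (ltW n0) nE') => w /Lc; lra.
have h3 := edist_functional u v (ltW n0) nE'.
rewrite -(ler_pM2l n0); lra.
Qed.

Variable p : R.
Hypothesis hp : 1 / 4 < p <= 1 / 3.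

Let p_gt0 : 0 < p := ratio_gt0 hp.

(** A half-plane that contains the image pulls back to one that contains the
    rhombus, with the normal vector scaled by [p]. *)
Lemma phi_deep i r v :
  deep (V p) r v -> deep (phi p i @` V p) (p * r) (phi p i v).
Proof.
move=> hv a b n m n0 nE hm.
have [c [d [e [f [cd E]]]]] := phi_similarity hp i.
have pn0 : 0 <= p * n by rewrite mulr_ge0 // ltW.
have pnE : (p * n) ^+ 2 = (a * c + b * d) ^+ 2 + (b * c - a * d) ^+ 2.
  by rewrite exprMn nE -cd; ring.
have := hv _ _ _ (m - (a * e + b * f)) pn0 pnE.
rewrite E /= => h.
suff : (a * c + b * d) * v.1 + (b * c - a * d) * v.2 + r * (p * n)
    <= m - (a * e + b * f) by lra.
apply: h => w Vw.
by have := hm (phi p i w) (ex_intro2 _ _ w Vw erefl); rewrite E /=; lra.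
Qed.

Lemma phi_word_deep (x : nat -> 'I_4 * bool) n r v :
  deep (V p) r v -> deep (V p) (p ^+ n * r) (phi_word p x n v).
Proof.
move=> hv; elim: n x => [|n IH] x; first by rewrite phi_word0 mul1r.
rewrite phi_wordS exprS -mulrA; apply: (@deep_subset (phi p (x 0%N) @` V p)).
  by move=> _ [z Vz <-]; exact: phi_sub_V.
exact: (@phi_deep _ _ _ (IH _)).
Qed.

Lemma phi_functional_le i (a b m : R) :
  (forall v, [\/ v = Pminus, v = Pplus, v = Qminus p | v = Qplus p] ->
    a * (phi p i v).1 + b * (phi p i v).2 <= m) ->
  forall v, (phi p i @` V p) v -> a * v.1 + b * v.2 <= m.
Proof.
move=> h _ [v Vv <-].
have [c [d [e [f [cd E]]]]] := phi_similarity hp i.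
have h1 := h _ (Or41 _ _ _ erefl).
have h2 := h _ (Or42 _ _ _ erefl).
have h3 := h _ (Or43 _ _ _ erefl).
have h4 := h _ (Or44 _ _ _ erefl).
rewrite !E /= in h1 h2 h3 h4 *.
suff : (a * c + b * d) * v.1 + (b * c - a * d) * v.2 <= m - (a * e + b * f) by lra.
by apply: (V_functional_le _ _ _ _ Vv); lra.
Qed.

(** The open set condition. The vertical axis separates the two left children
    from the two right ones, because [p <= 1/3] puts the inner vertex of the
    second child, whose abscissa is [(3 p - 1) / 2], on the left; the line
    that extends the side of the first child at its joint with the second
    separates these two, and its mirror image separates the last two. *)
Lemma children_separated (i j : 'I_4 * bool) : i.2 = j.2 -> (i.1 < j.1)%N ->
  exists a b c : R, [/\ 0 < a ^+ 2 + b ^+ 2,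
    forall w, (phi p i @` V p) w -> a * w.1 + b * w.2 <= c &
    forall w, (phi p j @` V p) w -> c <= a * w.1 + b * w.2].
Proof.
have q2 : q p ^+ 2 = 4 * p - 1 := q_sqr hp.
have q0 : 0 < q p := q_gt0 hp.
have p1 : 0 <= q p * (1 - 3 * p) by case/andP: hp => h1 h2; nra.
have p2 : 0 <= q p * (4 * p - 1) by case/andP: hp => h1 h2; nra.
have q3 : q p ^+ 3 = 4 * p * q p - q p by rewrite exprS q2; ring.
have hp1 : 1 / 4 < p by case/andP: hp.
have hp2 : p <= 1 / 3 by case/andP: hp.
suff H : i.2 = j.2 -> (i.1 < j.1)%N -> exists a b c : R, [/\ 0 < a ^+ 2 + b ^+ 2,
  forall v, [\/ v = Pminus, v = Pplus, v = Qminus p | v = Qplus p] ->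
    a * (phi p i v).1 + b * (phi p i v).2 <= c &
  forall v, [\/ v = Pminus, v = Pplus, v = Qminus p | v = Qplus p] ->
    - a * (phi p j v).1 + - b * (phi p j v).2 <= - c].
  move=> /H{}H /H[a [b [c [ab hi hj]]]]; exists a, b, c; split=> //.
    exact: phi_functional_le.
  by move=> w /(phi_functional_le hj); lra.
case: i j => [[i hi] s] [[j hj] s'] /= <- {s'}.
move: i hi j hj => [|[|[|[|//]]]] hi [|[|[|[|//]]]] hj //= _.
- case: s.
    exists (q p), (-1), (q p * (p - 1 / 2)); split; first by rewrite q2; lra.
      by move=> v [] -> /=; lra.
    by move=> v [] -> /=; lra.
  exists (q p), 1, (q p * (p - 1 / 2)); split; first by rewrite q2; lra.
    by move=> v [] -> /=; lra.
  by move=> v [] -> /=; lra.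
- by exists 1, 0, 0; split=> [|v []->|v []->]; case: s; rewrite /=; lra.
- by exists 1, 0, 0; split=> [|v []->|v []->]; case: s; rewrite /=; lra.
- by exists 1, 0, 0; split=> [|v []->|v []->]; case: s; rewrite /=; lra.
- by exists 1, 0, 0; split=> [|v []->|v []->]; case: s; rewrite /=; lra.
- case: s.
    exists (q p), 1, (q p * (1 / 2 - p)); split; first by rewrite q2; lra.
      by move=> v [] -> /=; lra.
    by move=> v [] -> /=; lra.
  exists (q p), (-1), (q p * (1 / 2 - p)); split; first by rewrite q2; lra.
    by move=> v [] -> /=; lra.
  by move=> v [] -> /=; lra.
Qed.

Lemma children_deep_separated (i j : 'I_4 * bool) r u v :
  i.2 = j.2 -> i.1 != j.1 -> deep (V p) r u -> deep (V p) r v ->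
  2 * (p * r) <= edist (phi p i u) (phi p j v).
Proof.
wlog lt_ij : i j u v / (i.1 < j.1)%N.
  move=> H ij ne hu hv; have [lt|lt|eq] := ltngtP i.1 j.1.
  - exact: H.
  - have -> : edist (phi p i u) (phi p j v) = edist (phi p j v) (phi p i u).
      by congr Num.sqrt; ring.
    by apply: H => //; rewrite eq_sym.
  - by case/eqP: ne; exact: val_inj.
move=> ij _ hu hv; have [a [b [c [ab hi hj]]]] := children_separated ij lt_ij.
exact: (deep_separated ab hi hj (@phi_deep _ _ _ hu) (@phi_deep _ _ _ hv)).
Qed.

(** The common endpoint of the first two children. *)
Definition joint : R^o * R^o := (p - 1 / 2, 0).

(** The vertices bound the coefficients of a half-plane [a x + b y <= c] by
    [|a| <= 2 c] and [|b| q <= 2 c]. Hence [n <= |a| + |b|] gives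
    [q n <= 4 c], while the value of the functional at [joint] is at most
    [c - 2 p c]. *)
Lemma joint_deep : deep (V p) (p * q p / 2) joint.
Proof.
move=> a b n c n0 nE h; have [VP VP' VQ VQ'] := V_vertices p.
have q0 : 0 < q p := q_gt0 hp; have q1 := q_le1 hp.
have hp1 : 1 / 4 < p by case/andP: hp.
have hp2 : p <= 1 / 3 by case/andP: hp.
have := h _ VP; have := h _ VP'; have := h _ VQ; have := h _ VQ'.
rewrite /= => h4 h3 h2 h1.
have a2 : `|a| <= 2 * c by rewrite ler_norml; apply/andP; split; lra.
have b2 : `|b| * q p <= 2 * c.
  rewrite -[X in `|b| * X]gtr0_norm // -normrM ler_norml.
  by apply/andP; split; lra.
have nab : n <= `|a| + `|b|.
  rewrite -(@ler_pXn2r _ 2) ?nnegrE ?addr_ge0 // nE sqrrD !real_normK ?num_real //.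
  by have := normr_ge0 (a * b); rewrite normrM; lra.
have c0 : 0 <= c by have := normr_ge0 a; lra.
have e1 : q p * n <= 4 * c.
  apply: (@le_trans _ _ (`|a| * q p + `|b| * q p)); first by nra.
  have : `|a| * q p <= `|a| by rewrite ler_piMr.
  lra.
have e2 : a * (p - 1 / 2) <= 2 * c * (1 / 2 - p).
  apply: (@le_trans _ _ (`|a| * (1 / 2 - p))); last by rewrite ler_wpM2r //; lra.
  have := ler_norm (- a); rewrite normrN; nra.
have : p / 2 * (q p * n) <= p / 2 * (4 * c) by rewrite ler_wpM2l //; lra.
lra.
Qed.

End Depth.

(** * Length *)

Section Length.
Context {R : realType}.
Implicit Types (g : R -> R^o * R^o) (t : R).

(** A polygon through points that are pairwise [e] apart has all its edges of
    length at least [e]. The nodes are the given times inside the open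
    interval, which loses at most the two times 0 and 1, followed by the node
    1; the edges to the end nodes 0 and 1 are estimated by 0. *)
Lemma polygon_length_separated g (I : finType) (tau : I -> R) (e : R) :
  0 < e -> (forall i, 0 <= tau i <= 1) ->
  (forall i j, i != j -> e <= edist (g (tau i)) (g (tau j))) ->
  exists2 ts, itv_partition 0 1 ts & (#|I|%:R - 3) * e <= polygon_length g ts.
Proof.
move=> e0 tau01 sep.
have tau_inj : injective tau.
  move=> i j ij; apply/eqP; apply: contraT => /sep.
  by rewrite ij /Defs.edist !subrr expr0n /= addr0 sqrtr0 leNgt e0.
pose all_times := [seq tau i | i <- enum I].
pose times := sort <=%O [seq x <- all_times | 0 < x < 1].
have all_uniq : uniq all_times by rewrite map_inj_uniq // enum_uniq.
have times_uniq : uniq times by rewrite sort_uniq filter_uniq.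
have times_in x : x \in times -> 0 < x < 1 /\ exists i, x = tau i.
  rewrite mem_sort mem_filter => /andP[x01 /mapP[i _ xE]].
  by split=> //; exists i.
have size_times : (#|I| <= size times + 2)%N.
  have -> : #|I| = size all_times by rewrite cardE /all_times size_map.
  rewrite size_sort size_filter -(count_predC (fun x : R => 0 < x < 1)) leq_add2l.
  rewrite -size_filter -[2%N]/(size [:: 0 : R; 1]).
  apply: uniq_leq_size; first exact: filter_uniq.
  move=> x; rewrite mem_filter => /andP[/= x01 /mapP[i _ xE]].
  have /andP[x0 x1] := tau01 i; rewrite -xE in x0 x1.
  rewrite !inE; move: x01; rewrite negb_and -!leNgt => /orP[h|h].
    by rewrite [x == 0]eq_le h x0.
  by rewrite [x == 1]eq_le h x1 orbT.
have times_path : path <%R 0 (rcons times 1).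
  have times_lt : sorted <%R times by rewrite sort_lt_sorted filter_uniq.
  rewrite rcons_path (path_sortedE (@lt_trans _ R)) times_lt andbT; apply/andP; split.
    by apply/allP => x /times_in[/andP[]].
  case: (lastP times) times_in => [_|l x h]; first exact: ltr01.
  rewrite last_rcons.
  by have [] := h x; [rewrite mem_rcons mem_head | case/andP].
exists (rcons times 1); first by split=> //; rewrite last_rcons.
have edges : \sum_(1 <= i < size times) e <= polygon_length g (rcons times 1).
  rewrite /polygon_length size_rcons.
  have [st|st] := posnP (size times).
    rewrite st big_geq //; apply: sumr_ge0 => i _; exact: edist_nneg.
  rewrite big_nat_recr //= (big_ltn (m := 0%N)) //=.
  rewrite -addrA ler_wpDl ?edist_nneg // ler_wpDr ?edist_nneg //.
  apply: ler_sum_nat => -[//|i] /andP[_ i1] /=.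
  have i2 : (i < size times)%N by exact: ltnW.
  rewrite !nth_rcons i1 i2.
  have [_ [j1 E1]] := times_in _ (mem_nth 1 i2).
  have [_ [j2 E2]] := times_in _ (mem_nth 1 i1).
  rewrite E1 E2; apply: sep; apply: contraTneq isT => j12.
  have := nth_uniq 1 i2 i1 times_uniq.
  by rewrite E1 E2 j12 eqxx ltn_eqF.
apply: le_trans edges; rewrite sumr_const_nat -[e *+ _]mulr_natl ler_wpM2r ?(ltW e0) //.
have : (#|I|%:R : R) <= (size times)%:R + 2 by rewrite -natrD ler_nat.
have [st|st] := posnP (size times); first by rewrite st sub0n; lra.
rewrite natrB //; lra.
Qed.

Variable p : R.
Hypothesis hp : 1 / 4 < p <= 1 / 3.
Variable s : koch_index.

Let p_gt0 : 0 < p := ratio_gt0 hp.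

(** The word [x], then 1, then zeros for ever: these digits lead to the image
    of [joint] in the cell of [x], because the first child fixes [Pminus] and
    the second sends it to [joint]. *)
Definition joint_digits k (x : k.-tuple 'I_4) : nat -> 'I_4 :=
  fun i => if (i < k)%N then nth ord0 x i
           else if i == k then @Ordinal 4 1 isT else ord0.

Definition joint_point k (x : k.-tuple 'I_4) : R^o * R^o :=
  cell_limit hp (omega s (joint_digits x)).

Lemma joint_pointE k (x : k.-tuple 'I_4) :
  joint_point x = phi_word p (omega s (joint_digits x)) k (joint p).
Proof.
have [VP _ _ _] := V_vertices p.
rewrite /joint_point (@cell_limit_fixed _ _ _ _ k.+1 Pminus) //.
  rewrite phi_word_recr; congr (phi_word _ _ _ _).
  rewrite /omega /joint_digits ltnn eqxx /phi /joint /=.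
  by case: (s _); congr pair; field.
move=> i; apply: phi_first_fixed.
rewrite /= /joint_digits ltnNge (leq_trans (leqnSn k) (leq_addr i k.+1)) /=.
by rewrite gtn_eqF // addSn ltnS leq_addr.
Qed.

(** Let [j] be the first place where the words differ. The two points then lie
    in different children of one cell of rank [j], with the same bit, and each
    is as deep in its child as [joint] is in the rhombus, up to the scale. *)
Lemma joint_points_separated k (x y : k.-tuple 'I_4) : x != y ->
  p * q p * p ^+ k <= edist (joint_point x) (joint_point y).
Proof.
move=> xy; set d := joint_digits x; set e := joint_digits y.
have ex_diff : exists i, (i < k)%N && (d i != e i).
  apply: contrapT => h; case/eqP: xy; apply: val_inj.
  apply: (@eq_from_nth _ ord0); rewrite !size_tuple // => i ik.
  apply/eqP; apply: contrapT => /negP ne; apply: h; exists i.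
  by rewrite ik /d /e /joint_digits ik.
pose j := ex_minn ex_diff.
have [jk dj before] : [/\ (j < k)%N, d j != e j & forall i, (i < j)%N -> d i = e i].
  rewrite /j; case: ex_minnP => i /andP[ik di] mini; split=> // i' i'i.
  apply/eqP; apply: contraTT i'i => h; rewrite -leqNgt; have [i'k|ki'] := ltnP i' k.
    by apply: mini; rewrite i'k.
  exact: leq_trans (ltnW ik) ki'.
have addr : address d j = address e j by exact: eq_address.
rewrite !joint_pointE -/d -/e.
set m := (k - j.+1)%N; have kE : k = (j + m.+1)%N by rewrite /m addnS -addSn subnKC.
have wordE w v : phi_word p w k v =
    phi_word p w j (phi p (w j) (phi_word p ((w \o addn j) \o succn) m v)).
  by rewrite [in LHS]kE phi_word_cat phi_wordS /comp addn0.
have -> : p ^+ k = p ^+ j * (p * p ^+ m) by rewrite kE exprD exprS.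
rewrite !wordE (eq_phi_word p (address_omega s addr)) (edist_phi_word hp).
have := @children_deep_separated R p hp (omega s d j) (omega s e j)
  (p ^+ m * (p * q p / 2)) _ _ (omega_bit s addr) dj
  (@phi_word_deep R p hp ((omega s d \o addn j) \o succn) m _ _ (joint_deep hp))
  (@phi_word_deep R p hp ((omega s e \o addn j) \o succn) m _ _ (joint_deep hp)).
move/(ler_wpM2l (exprn_ge0 j (ltW p_gt0))); apply: le_trans.
by rewrite le_eqVlt; apply/orP; left; apply/eqP; field.
Qed.

(** The [4 ^ k] joints of rank [k] are attained at distinct times, whatever
    the parametrisation, and are at least [p q p ^ k] apart; the inscribed
    polygon is at least [(4 ^ k - 3) p q p ^ k] long, which tends to infinity
    because [4 p > 1]. *)
Lemma path_length_koch g :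
  parametrises g (koch_curve p s) -> path_length g = +oo%E.
Proof.
move=> [_ gC]; apply: eq_infty => L.
have hp1 : 1 / 4 < p by case/andP: hp.
have q0 := q_gt0 hp.
have pre k (x : k.-tuple 'I_4) : exists t, 0 <= t <= 1 /\ g t = joint_point x.
  have : koch_curve p s (joint_point x).
    by rewrite (koch_curveE hp); exists (joint_digits x).
  by rewrite -gC => -[t]; rewrite /= in_itv /= => t01 <-; exists t.
pose B := `|L| / (p * q p) + 3.
have B0 : 0 < B by rewrite ltr_wpDl // divr_ge0 // mulr_ge0 // ltW.
have [k hk] : exists k, B < (4 * p) ^+ k.
  have x01 : 0 <= (4 * p)^-1 < 1 by rewrite invr_ge0 invf_lt1; lra.
  have Bi0 : 0 < B^-1 by rewrite invr_gt0.
  have [k] := exists_expr_lt x01 Bi0.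
  by rewrite exprVn ltf_pV2 ?posrE ?exprn_gt0 //; [exists k | lra].
pose tau (x : k.-tuple 'I_4) := projT1 (cid (pre k x)).
have tauP x : 0 <= tau x <= 1 /\ g (tau x) = joint_point x := projT2 (cid (pre k x)).
have e0 : 0 < p * q p * p ^+ k by rewrite !mulr_gt0 // exprn_gt0.
have sep (x y : k.-tuple 'I_4) : x != y ->
    p * q p * p ^+ k <= edist (g (tau x)) (g (tau y)).
  by rewrite (tauP x).2 (tauP y).2; exact: joint_points_separated.
have [ts tsP tsL] := polygon_length_separated e0 (fun x => (tauP x).1) sep.
apply: (@le_trans _ _ (polygon_length g ts)%:E); last first.
  by apply: ereal_sup_ubound; exists ts.
rewrite lee_fin; apply: le_trans tsL; rewrite card_tuple card_ord natrX.
apply: le_trans (ler_norm L) _.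
have -> : `|L| = (B - 3) * (p * q p).
  by rewrite /B addrK divfK // mulf_neq0 // gt_eqF.
have -> : (4 ^+ k - 3) * (p * q p * p ^+ k) =
    ((4 * p) ^+ k - 3 * p ^+ k) * (p * q p) by rewrite exprMn; ring.
rewrite ler_wpM2r ?mulr_ge0 ?ltW //.
have : p ^+ k <= 1.
  by case/andP: hp => _ hp2; apply: exprn_ile1; [exact: ltW | lra].
lra.
Qed.

Lemma curve_length_koch : curve_length (koch_curve p s) = +oo%E.
Proof.
apply/ereal_inf_pinfty => _ [g pg <-]; exact: path_length_koch.
Qed.

End Length.

Unset Implicit Arguments.

Theorem mainTheorem5 (R : realType) (p : R) (s : koch_index)
  (hp : 1 / 4 < p <= 1 / 3) :
  (exists g : R -> R^o * R^o,
     [/\ parametrises g (koch_curve p s), g 0 = Pminus & g 1 = Pplus]) /\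
  curve_length (koch_curve p s) = +oo%E.
Proof.
split; last exact: curve_length_koch.
exists (koch_param hp s); split.
- exact: koch_param_parametrises.
- exact: koch_param0.
- exact: koch_param1.
Qed.
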